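(* There exists a first order convergent sequence of finite matroids, each of rank (at most) three and representable over $\mathbb{Q}$, that has no limit matroid modeling.
   Context: Language: $\lambda_M$ contains a $k$-ary relation symbol $I_k$ for each $k\ge1$; a matroid is a $\lambda_M$-structure where $I_k(x_1,\dots,x_k)$ holds iff $x_1,\dots,x_k$ form an independent set of size $k$. A $\lambda$-modeling is a $\lambda$-structure on a standard Borel space with probability measure $\nu$ such that all first-order definable sets $A^\varphi\subseteq A^k$ are $\nu^k$-measurable; Stone pairing $\langle\varphi,A\rangle=\nu^k(A^\varphi)$ (uniform measure for finite structures). A sequence of finite matroids is first order convergent if $\langle\varphi,M_n\rangle$ converges for every first order $\lambda_M$-formula $\varphi$. A limit matroid modeling of the sequence is a $\lambda_M$-modeling that is an infinite matroid (in the sense of Bruhn et al., defined via circuit axioms (C1), (C2), (C3'), (CM)) with $\langle\varphi,\mathbf{M}\rangle=\lim_n\langle\varphi,M_n\rangle$ for every first order $\lambda_M$-formula $\varphi$. *)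

(* Defs.v *)
From HB Require Import structures.
From mathcomp Require Import all_boot all_order all_algebra.
From mathcomp Require Import all_classical all_reals.
From mathcomp Require Import topology normedtype sequences measure lebesgue_measure
  lebesgue_integral probability.

Unset Strict Implicit.
Unset Printing Implicit Defensive.

Import Order.TTheory GRing.Theory Num.Theory.
Import numFieldNormedType.Exports.
Local Open Scope ring_scope.

(* First-order logic over the language lambda_M = {I_k : k >= 1}       *)
(* (with equality).  A formula of type [formula n] has its free        *)
(* variables among x_0, ..., x_{n-1}; [FExists] binds the variable     *)
(* with the largest index n.                                          *)
(* [FRel k args] is the atom I_{k+1}(x_{args 0}, ..., x_{args k}).      *)
Inductive formula : nat -> Type :=
| FEq {n} : 'I_n -> 'I_n -> formula n
| FRel {n} (k : nat) : ('I_k.+1 -> 'I_n) -> formula n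
| FNot {n} : formula n -> formula n
| FAnd {n} : formula n -> formula n -> formula n
| FOr {n} : formula n -> formula n -> formula n
| FExists {n} : formula n.+1 -> formula n
| FForall {n} : formula n.+1 -> formula n.

(* A lambda_M-structure on a carrier T: [A k x] means I_{k+1}(x 0,...,x k). *)
Definition lamM_structure (T : Type) := forall k : nat, ('I_k.+1 -> T) -> Prop.

Definition ext_asg {T : Type} {n : nat} (v : 'I_n -> T) (x : T) : 'I_n.+1 -> T :=
  fun i => match unlift ord_max i with Some j => v j | None => x end.

Fixpoint sat {T : Type} (A : lamM_structure T) {n : nat} (phi : formula n)
  : ('I_n -> T) -> Prop :=
  match phi in formula n return ('I_n -> T) -> Prop with
  | FEq _ i j => fun v => v i = v j
  | FRel _ k a => fun v => A k (fun l => v (a l))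
  | FNot _ p => fun v => ~ sat A p v
  | FAnd _ p q => fun v => sat A p v /\ sat A q v
  | FOr _ p q => fun v => sat A p v \/ sat A q v
  | FExists _ p => fun v => exists x, sat A p (ext_asg v x)
  | FForall _ p => fun v => forall x, sat A p (ext_asg v x)
  end.

Record fin_matroid := FinMatroid {
  fm_type : finType;
  fm_indep : {set fm_type} -> bool;
  fm_nonempty : (0 < #|fm_type|)%N;
  fm_I1 : fm_indep (@finset.set0 fm_type);
  fm_I2 : forall A B : {set fm_type}, B \subset A -> fm_indep A -> fm_indep B;
  fm_I3 : forall A B : {set fm_type}, fm_indep A -> fm_indep B -> (#|A| < #|B|)%N ->
            exists2 x, x \in B :\: A & fm_indep (x |: A)
}.
Arguments fm_indep : clear implicits.

Definition fm_structure (M : fin_matroid) : lamM_structure (fm_type M) :=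
  fun k x => injective x /\ fm_indep M [set x i | i : 'I_k.+1].

Definition fm_rank_le (M : fin_matroid) (r : nat) : Prop :=
  forall S : {set fm_type M}, fm_indep M S -> (#|S| <= r)%N.

Definition representable_Q (M : fin_matroid) : Prop :=
  exists (m : nat) (f : fm_type M -> 'rV[rat]_m),
    forall S : {set fm_type M}, fm_indep M S = free [seq f x | x <- enum S].

Definition stone_fin (R : realType) (M : fin_matroid) {k : nat} (phi : formula k) : R :=
  (#|[set v : {ffun 'I_k -> fm_type M} | `[< sat (fm_structure M) phi v >] ]|%:R
     / (#|fm_type M| ^ k)%N%:R).

Definition fo_convergent (R : realType) (M : nat -> fin_matroid) : Prop :=
  forall (k : nat) (phi : formula k), cvgn (fun n => stone_fin R (M n) phi).

Local Open Scope classical_set_scope.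

Definition tcons {T : Type} {k : nat} (x : T) (v : 'I_k -> T) : 'I_k.+1 -> T :=
  fun i => match unlift ord0 i with Some j => v j | None => x end.

Definition prodn_measurable {d} {T : measurableType d} (k : nat)
  : set (set ('I_k -> T)) :=
  <<s [set C | exists (i : 'I_k) (B : set T), measurable B /\ C = [set v | B (v i)] ] >>.

Fixpoint prodn_measure {d} {T : measurableType d} {R : realType}
  (nu : {measure set T -> \bar R}) (k : nat) : set ('I_k -> T) -> \bar R :=
  match k return set ('I_k -> T) -> \bar R with
  | 0 => fun S => if `[< exists v, S v >] then 1%E else 0%E
  | k'.+1 => fun S => (\int[nu]_x prodn_measure nu k' (fun v => S (tcons x v)))%E
  end.

Definition standard_borel {d} (T : measurableType d) (R : realType) : Prop :=
  exists f : T -> R,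
    [/\ injective f, measurable (range f), measurable_fun setT f &
        forall S : set T, measurable S -> measurable (f @` S)].

Definition is_modeling {d} {T : measurableType d} {R : realType}
  (P : probability T R) (A : lamM_structure T) : Prop :=
  standard_borel T R /\
  forall (k : nat) (phi : formula k), prodn_measurable k [set v | sat A phi v].

Definition stone_modeling {d} {T : measurableType d} {R : realType}
  (P : probability T R) (A : lamM_structure T) {k : nat} (phi : formula k) : \bar R :=
  prodn_measure P k [set v | sat A phi v].

(* Infinite matroids via circuit axioms (Bruhn et al.)                 *)
Definition indep_C {T : Type} (C : set (set T)) (I : set T) : Prop :=
  forall X, C X -> ~ (X `<=` I).

Definition circuit_axioms {T : Type} (C : set (set T)) : Prop :=
  [/\ (* (C1) *) ~ C set0,
      (* (C2) *) (forall X Y, C X -> C Y -> X `<=` Y -> X = Y),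
      (forall (X C0 : set T) (Cx : T -> set T),
          C C0 -> X `<=` C0 -> (forall x, X x -> C (Cx x)) ->
          (forall x y, X x -> X y -> (Cx y x <-> x = y)) ->
          forall z, C0 z -> ~ (\bigcup_(x in X) Cx x) z ->
          exists C', [/\ C C', C' z & C' `<=` (C0 `|` \bigcup_(x in X) Cx x) `\` X]) &
      (forall I X : set T, indep_C C I -> I `<=` X ->
          exists Mx, [/\ indep_C C Mx, I `<=` Mx, Mx `<=` X &
             forall M', indep_C C M' -> Mx `<=` M' -> M' `<=` X -> M' = Mx])].

Definition is_matroid_structure {T : Type} (A : lamM_structure T) : Prop :=
  exists C : set (set T), circuit_axioms C /\
    forall (k : nat) (x : 'I_k.+1 -> T), A k x <-> (injective x /\ indep_C C (range x)).

Definition has_limit_matroid_modeling (R : realType) (M : nat -> fin_matroid) : Prop :=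
  exists (d : measure_display) (T : measurableType d) (P : probability T R)
         (A : lamM_structure T),
    [/\ is_modeling P A, is_matroid_structure A &
        forall (k : nat) (phi : formula k),
          stone_modeling P A phi = (limn (fun n => stone_fin R (M n) phi))%:E].

(* Main.v *)
(** The points (1, a, a^3) of the cuspidal cubic, with a rational, are independent in triples
    unless two coincide or the three parameters sum to 0.  For a prime p take the parameters
    p + x with x in {0, ..., p-1}, each once, and -2p - w, each twice, where w < 2p is a
    quadratic residue mod p.  Being parallel to another point is definable and tells the two
    kinds apart, so the graph "x + y is a quadratic residue" on the simple points is definable
    too.  It is quasi-random: with signs +1 and -1 for edges and non-edges, the codegree of two
    distinct vertices is bounded by character-sum orthogonality, so the formulas for 4-cycles of
    sign +1 and of sign -1 have asymptotically equal Stone pairings.  In a limit modeling the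
    sign function h on pairs of simple points would have codegrees vanishing almost everywhere,
    hence be orthogonal to all rectangles, hence be null; but |h| = 1 on a set of positive
    measure. *)

Require Import Defs.
From mathcomp Require Import all_boot all_order all_algebra.
From mathcomp Require Import all_classical all_reals.
From mathcomp Require Import topology normedtype sequences measure lebesgue_measure
  lebesgue_integral probability measurable_realfun numfun
  interval_inference num_normedtype.
From mathcomp Require Import finfield ring zify.
Import Order.TTheory GRing.Theory Num.Theory.
Import numFieldNormedType.Exports.
Local Open Scope ring_scope.

(** * Quadratic character sums over finite fields of odd characteristic *)

Definition quad_char {F : finFieldType} (z : F) : int :=
  if z == 0 then 0 else if z ^+ (#|F|.-1./2) == 1 then 1 else -1.

(** If [#|F|] were even, raising -1 to this power would give both -1 and 1, so 2 would vanish. *)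
Lemma odd_card_field (F : finFieldType) : (2%:R : F) != 0 -> odd #|F|.
Proof.
apply: contraR => evF; have := expf_card (-1 : F).
by rewrite -signr_odd (negbTE evF) expr0 => /eqP; rewrite -addr_eq0.
Qed.

(** The square of this power is [z ^+ #|F|.-1], which is 1 for nonzero [z]. *)
Lemma half_power_sign (F : finFieldType) (z : F) : (2%:R : F) != 0 -> z != 0 ->
  (z ^+ (#|F|.-1./2) == 1) || (z ^+ (#|F|.-1./2) == -1).
Proof.
move=> F2 z0; rewrite -sqrf_eq1 -exprM muln2.
have oF := odd_card_field F F2.
have cF : #|F| = (#|F|.-1).+1 by rewrite prednK //; case: #|F| oF.
rewrite even_halfK; last by move: oF; rewrite {1}cF.
have := expf_card z; rewrite {1}cF exprS => e.
by apply/eqP/(mulfI z0); rewrite mulr1.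
Qed.

Lemma quad_char0 (F : finFieldType) : quad_char (0 : F) = 0.
Proof. by rewrite /quad_char eqxx. Qed.

Lemma quad_char1 (F : finFieldType) : quad_char (1 : F) = 1.
Proof. by rewrite /quad_char oner_eq0 expr1n eqxx. Qed.

Lemma quad_charM (F : finFieldType) (x y : F) : (2%:R : F) != 0 ->
  quad_char (x * y) = quad_char x * quad_char y.
Proof.
move=> F2; rewrite /quad_char mulf_eq0.
have [->|x0] := eqVneq x 0; first by rewrite !mul0r.
have [->|y0] := eqVneq y 0; first by rewrite orbT !mulr0.
have N1 : ((-1 : F) == 1) = false.
  by apply/negbTE; apply: contra F2 => N; rewrite -[2%:R]/(1 + 1) addr_eq0 eq_sym.
rewrite /= exprMn.
by case/orP: (half_power_sign F x F2 x0) => /eqP->;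
  case/orP: (half_power_sign F y F2 y0) => /eqP->;
  rewrite ?mulr1 ?mul1r ?mulN1r ?opprK ?N1 ?eqxx.
Qed.

Lemma quad_char_sq (F : finFieldType) (x : F) : x != 0 ->
  quad_char x * quad_char x = 1.
Proof. by rewrite /quad_char => /negbTE->; case: ifP. Qed.

Lemma quad_char_norm (F : finFieldType) (x : F) : `|quad_char x| <= 1.
Proof. by rewrite /quad_char; do 2?case: ifP. Qed.

(** Otherwise all [#|F|.-1] nonzero elements would be roots of unity of order [m], only half that
    number. *)
Lemma nonresidue (F : finFieldType) : (2%:R : F) != 0 ->
  exists g : F, quad_char g = -1.
Proof.
move=> F2; set m := #|F|.-1./2.
have oF := odd_card_field F F2.
have cF : (1 < #|F|)%N by exact: finNzRing_gt1.
have m0 : (0 < m)%N by rewrite /m; lia.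
have [/forallP H|/forallPn[g]] := boolP [forall g : F, (g == 0) || (g ^+ m == 1)]; last first.
  by rewrite negb_or => /andP[/negbTE g0 /negbTE gm]; exists g; rewrite /quad_char g0 gm.
have := @max_unity_roots _ m (enum [pred g : F | g != 0]) m0.
rewrite enum_uniq -cardE cardC1 => H1.
suff : (#|F|.-1 <= m)%N by rewrite /m; lia.
apply: H1 => //; apply/allP => g; rewrite mem_enum unity_rootE inE.
by have := H g; case: eqP.
Qed.

(** Multiplication by a non-residue permutes the field and flips every sign, so the sum is its own
    negative. *)
Lemma sum_quad_char (F : finFieldType) : (2%:R : F) != 0 ->
  \sum_(z : F) quad_char z = 0.
Proof.
move=> F2; have [g gN] := nonresidue F F2.
have g0 : g != 0 by apply: contra_eqN gN => /eqP->; rewrite quad_char0.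
have E : \sum_(z : F) quad_char z = - \sum_(z : F) quad_char z.
  rewrite {1}(reindex (fun z => g * z)) /=; last first.
    by exists (fun z => g^-1 * z) => z _; rewrite mulrA ?mulVf ?mulfV ?mul1r.
  rewrite -sumrN; apply: eq_bigr => z _.
  by rewrite quad_charM // gN mulN1r.
lia.
Qed.

(** For nonzero [z] the term equals [quad_char (1 + d / z)], because [quad_char z] squares to 1.
    These arguments run over all of [F] except 1, so the sum is the full character sum, which is 0,
    minus [quad_char 1]. *)
Lemma quad_char_corr (F : finFieldType) (d : F) : (2%:R : F) != 0 -> d != 0 ->
  \sum_(z : F) quad_char z * quad_char (z + d) = -1.
Proof.
move=> F2 d0.
(* Since the inverse of 0 is 0 by convention, [z |-> 1 + d / z] permutes all of [F] and sends 0 to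
   1. *)
have S0 : \sum_(z : F) quad_char (1 + d / z) = 0.
  rewrite -[RHS](sum_quad_char F F2) [RHS](reindex (fun z => 1 + d / z)) //=.
  exists (fun t => d / (t - 1)) => z _.
    by rewrite addrAC subrr add0r invf_div mulrC divfK.
  by rewrite invf_div mulrC divfK // subrKC.
rewrite (bigD1 0) //= quad_char0 mul0r add0r.
move: S0; rewrite (bigD1 0) //= invr0 mulr0 addr0 quad_char1 => /eqP.
rewrite addrC addr_eq0 => /eqP<-; apply: eq_bigr => z z0.
have -> : z + d = z * (1 + d / z) by field.
by rewrite quad_charM // mulrA quad_char_sq // mul1r.
Qed.

(** * Matroids of rational vector families *)

Section VectorMatroid.
Context {T : finType} {m : nat} (f : T -> 'rV[rat]_m).

(** The list of images keeps repetitions, so two elements carrying the same vector are dependent;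
    this provides the parallel pairs below. *)
Definition vec_indep (S : {set T}) : bool := free [seq f x | x <- enum S].

Lemma vec_indepE (S : {set T}) (s : seq T) :
  uniq s -> S =i s -> vec_indep S = free [seq f x | x <- s].
Proof.
move=> us eS; apply/perm_free/perm_map/uniq_perm => //; first exact: enum_uniq.
by move=> x; rewrite mem_enum eS.
Qed.

Lemma vec_indep0 : vec_indep finset.set0.
Proof. by rewrite /vec_indep enum_set0 nil_free. Qed.

Lemma vec_indepS (A B : {set T}) : B \subset A -> vec_indep A -> vec_indep B.
Proof.
move=> sBA; rewrite (vec_indepE A (enum B ++ enum (A :\: B))) ?map_cat.
- exact: catl_free.
- rewrite cat_uniq !enum_uniq andbT /=; apply/hasPn => x.
  by rewrite !mem_enum inE => /andP[].
- move=> x; rewrite mem_cat !mem_enum inE; case: (boolP (x \in B)) => //=.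
  exact: (fintype.subsetP sBA).
Qed.

Lemma vec_indepU1 (A : {set T}) x : x \notin A ->
  vec_indep (x |: A) = (f x \notin <<[seq f y | y <- enum A]>>%VS) && vec_indep A.
Proof.
move=> xA; rewrite (vec_indepE _ (x :: enum A)) /= ?free_cons //.
  by rewrite mem_enum xA enum_uniq.
by move=> y; rewrite !inE mem_enum.
Qed.

(** If no element of [B :\: A] extends [A], the span of [B] lies in that of [A], and comparing
    dimensions gives [#|B| <= #|A|]. *)
Lemma vec_indep_exchange (A B : {set T}) : vec_indep A -> vec_indep B ->
  (#|A| < #|B|)%N -> exists2 x, x \in B :\: A & vec_indep (x |: A).
Proof.
move=> iA iB ltAB; apply/exists_inP; apply: contraLR ltAB => /exists_inPn H.
rewrite -leqNgt !cardE -(size_map f (enum A)) -(size_map f (enum B)).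
rewrite -(eqP (iA : _ == _)) -(eqP (iB : _ == _)); apply/dimvS/span_subvP => _ /mapP[x + ->].
rewrite mem_enum => xB; case: (boolP (x \in A)) => xA.
  by apply/memv_span/map_f; rewrite mem_enum.
have := H x; rewrite finset.in_setD xA xB => /(_ isT).
by rewrite vec_indepU1 // iA andbT negbK.
Qed.

Definition vector_matroid (T0 : (0 < #|T|)%N) : fin_matroid :=
  @FinMatroid T vec_indep T0 vec_indep0 vec_indepS vec_indep_exchange.

Lemma vector_matroid_rank (T0 : (0 < #|T|)%N) : fm_rank_le (vector_matroid T0) m.
Proof.
move=> S iS; rewrite cardE -(size_map f).
have /eqP <- : free [seq f x | x <- enum S] by [].
by rewrite (leq_trans (dimvS (subvf _))) // dimvf /dim /= mul1n.
Qed.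

Lemma vector_matroid_representable (T0 : (0 < #|T|)%N) :
  representable_Q (vector_matroid T0).
Proof. by exists m, f. Qed.

End VectorMatroid.

(** * Collinearity on the cuspidal cubic *)

Definition cubic_point (a : rat) : 'rV[rat]_3 :=
  \row_(j < 3) nth 0 [:: 1; a; a ^+ 3] j.

Lemma cubic_point_in_line (a b : rat) :
  (cubic_point a \in <[cubic_point b]>%VS) = (a == b).
Proof.
apply/vlineP/eqP => [[k /rowP e]|->]; last by exists 1; rewrite scale1r.
move: (e 0) (e 1); rewrite !mxE /= mulr1 => <-.
by rewrite mul1r.
Qed.

(** Up to sign, the determinant of the three points is [(b - c) * (a - b) * (a - c) * (a + b +
    c)]. *)
Lemma cubic_point_in_plane (a b c : rat) : b != c ->
  (cubic_point a \in <<[:: cubic_point b; cubic_point c]>>%VS)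
  = [|| a == b, a == c | a + b + c == 0].
Proof.
move=> bc; have bc0 : b - c != 0 by rewrite subr_eq0.
rewrite span_cons span_seq1; apply/memv_addP/idP.
  move=> [_ /vlineP[k ->] [_ /vlineP[l ->] /rowP e]].
  move: (e 0) (e 1) (e (inord 2)); rewrite !mxE /= inordK //= !mulr1 => e0 e1 e2.
  have el : l = 1 - k by rewrite e0; ring.
  have ek : a - c = k * (b - c) by rewrite e1 el; ring.
  rewrite -(subr_eq0 a b) -(subr_eq0 a c) -!mulf_eq0; apply/eqP.
  suff : (b - c) * ((a - b) * ((a - c) * (a + b + c))) = 0.
    by move/eqP; rewrite mulf_eq0 (negbTE bc0) => /eqP.
  have -> : (b - c) * ((a - b) * ((a - c) * (a + b + c))) =
    (b - c) * (a ^+ 3 - c ^+ 3) - (a - c) * (b ^+ 3 - c ^+ 3) by ring.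
  have -> : a ^+ 3 - c ^+ 3 = k * (b ^+ 3 - c ^+ 3).
    by rewrite e2 el; ring.
  by rewrite ek; ring.
(* The coefficients are those of linear interpolation at [b] and [c]. They match the first two
   coordinates, and the third is off by the product that [E] shows to be 0. *)
move=> H; exists (((a - c) / (b - c)) *: cubic_point b); first exact/memvZ/memv_line.
exists (((b - a) / (b - c)) *: cubic_point c); first exact/memvZ/memv_line.
have E : (a - b) * (a - c) * (a + b + c) = 0.
  by case/or3P: H => /eqP h; rewrite h; ring.
apply/rowP => j; rewrite !mxE.
case: j => [[|[|[|//]]]] ? /=; [by field|by field|].
apply/eqP; rewrite -subr_eq0; apply/eqP.
have -> : a ^+ 3 - ((a - c) / (b - c) * b ^+ 3 + (b - a) / (b - c) * c ^+ 3) =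
   (a - b) * (a - c) * (a + b + c) by field.
by [].
Qed.

(** * Atomic formulas in matroids on the cubic *)

Definition pair_asg {T : Type} (x y : T) : 'I_2 -> T := fun l => nth x [:: x; y] l.
Definition triple_asg {T : Type} (x y z : T) : 'I_3 -> T :=
  fun l => nth x [:: x; y; z] l.

Lemma pair_asg_comp {T U : Type} (v : T -> U) (x y : T) :
  (fun l => v (pair_asg x y l)) = pair_asg (v x) (v y).
Proof. by apply/funext => -[[|[|//]]]. Qed.

Lemma triple_asg_comp {T U : Type} (v : T -> U) (x y z : T) :
  (fun l => v (triple_asg x y z l)) = triple_asg (v x) (v y) (v z).
Proof. by apply/funext => -[[|[|[|//]]]]. Qed.

Lemma nth_asg_injective {T : eqType} (x0 : T) (s : seq T) (k : nat) : size s = k ->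
  injective (fun l : 'I_k => nth x0 s l) <-> uniq s.
Proof.
move=> <-; split=> [inj|us i j /eqP]; last by rewrite nth_uniq // => /eqP/val_inj.
apply/(uniqP x0) => i j ilt jlt e.
by have := inj (Ordinal ilt) (Ordinal jlt) e => /(congr1 val).
Qed.

Lemma nth_asg_image {T : finType} (x0 : T) (s : seq T) (k : nat) : size s = k ->
  [set nth x0 s l | l : 'I_k]%SET =i s.
Proof.
move=> <- x; apply/imsetP/idP => [[l _ ->]|xs]; first exact: mem_nth.
by exists (Ordinal (etrans (index_mem x s) xs)); rewrite //= nth_index.
Qed.

Definition cubic_matroid {T : finType} (g : T -> rat) (T0 : (0 < #|T|)%N) :=
  vector_matroid (fun x => cubic_point (g x)) T0.

(** Elements with distinct parameters are distinct, so the injectivity clause of [fm_structure] is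
    absorbed by the right-hand side. *)
Lemma cubic_matroid_line (T : finType) (g : T -> rat) (T0 : (0 < #|T|)%N) (x y : T) :
  fm_structure (cubic_matroid g T0) 1%N (pair_asg x y) <-> g x != g y.
Proof.
rewrite /fm_structure /=; split=> [[/(nth_asg_injective x [:: x; y] 2%N erefl) us]|gxy].
  rewrite (vec_indepE _ _ [:: x; y] us); last exact: nth_asg_image.
  by rewrite /= free_cons span_seq1 cubic_point_in_line => /andP[].
have us : uniq [:: x; y] by rewrite /= inE andbT; apply: contra_neq gxy => ->.
split; first exact/(nth_asg_injective x [:: x; y]).
rewrite (vec_indepE _ _ [:: x; y] us); last exact: nth_asg_image.
rewrite /= free_cons span_seq1 cubic_point_in_line gxy seq1_free.
by apply/eqP => /rowP/(_ 0); rewrite !mxE.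
Qed.

Lemma cubic_matroid_plane (T : finType) (g : T -> rat) (T0 : (0 < #|T|)%N) (x y z : T) :
  fm_structure (cubic_matroid g T0) 2%N (triple_asg x y z) <->
  uniq [:: g x; g y; g z] && (g x + g y + g z != 0).
Proof.
have E : uniq [:: x; y; z] -> vec_indep (fun x => cubic_point (g x))
     [set triple_asg x y z l | l : 'I_3]%SET =
     uniq [:: g x; g y; g z] && (g x + g y + g z != 0).
  move=> us; rewrite (vec_indepE _ _ [:: x; y; z] us); last exact: nth_asg_image.
  rewrite /= !free_cons span_seq1 cubic_point_in_line nil_free span_nil memv0 !inE.
  have -> : cubic_point (g z) != 0 by apply/eqP => /rowP/(_ 0); rewrite !mxE.
  case: (eqVneq (g y) (g z)) => [->|yz]; first by rewrite /= !andbF.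
  by rewrite cubic_point_in_plane // !andbT !negb_or andbA.
rewrite /fm_structure /=; split=> [[/(nth_asg_injective x [:: x; y; z] 3%N erefl) us]|H].
  by rewrite E.
have us : uniq [:: x; y; z] by case/andP: H => /(@map_uniq _ _ g [:: x; y; z]).
by split; [exact/(nth_asg_injective x [:: x; y; z])|rewrite E].
Qed.

(** * Countability of the formulas *)

(** The code omits [n]: the decoder receives it as an argument and raises it under quantifiers. *)
Fixpoint formula_code {n : nat} (phi : formula n) : GenTree.tree nat :=
  match phi with
  | FEq _ i j => GenTree.Node 0 [:: GenTree.Leaf (i : nat); GenTree.Leaf (j : nat)]
  | FRel _ k a => GenTree.Node 1 [:: GenTree.Leaf k; GenTree.Leaf (pickle (finfun a))]
  | FNot _ p => GenTree.Node 2 [:: formula_code p]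
  | FAnd _ p q => GenTree.Node 3 [:: formula_code p; formula_code q]
  | FOr _ p q => GenTree.Node 4 [:: formula_code p; formula_code q]
  | FExists _ p => GenTree.Node 5 [:: formula_code p]
  | FForall _ p => GenTree.Node 6 [:: formula_code p]
  end.

Fixpoint formula_decode (t : GenTree.tree nat) (n : nat) : option (formula n) :=
  match t with
  | GenTree.Node 0 [:: GenTree.Leaf i; GenTree.Leaf j] =>
      obind (fun i' => omap (FEq i') (insub j)) (insub i)
  | GenTree.Node 1 [:: GenTree.Leaf k; GenTree.Leaf c] =>
      omap (fun a : {ffun 'I_k.+1 -> 'I_n} => FRel k a) (unpickle c)
  | GenTree.Node 2 [:: p] => omap FNot (formula_decode p n)
  | GenTree.Node 3 [:: p; q] =>
      obind (fun p' => omap (FAnd p') (formula_decode q n)) (formula_decode p n)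
  | GenTree.Node 4 [:: p; q] =>
      obind (fun p' => omap (FOr p') (formula_decode q n)) (formula_decode p n)
  | GenTree.Node 5 [:: p] => omap FExists (formula_decode p n.+1)
  | GenTree.Node 6 [:: p] => omap FForall (formula_decode p n.+1)
  | _ => None
  end.

Lemma formula_codeK n : pcancel formula_code (formula_decode^~ n).
Proof.
elim=> {n} [n i j|n k a|n p|n p IHp q IHq|n p IHp q IHq|n p|n p] /=.
- by rewrite !valK.
- by rewrite pickleK /=; congr (Some (FRel k _)); apply/funext => l; rewrite ffunE.
- by move->.
- by rewrite IHp /= IHq.
- by rewrite IHp /= IHq.
- by move->.
- by move->.
Qed.

(** * Definable adjacency and signed 4-cycles *)

Definition is_simple {T : Type} (A : lamM_structure T) (x : T) : Prop :=
  forall y, x = y \/ A 1%N (pair_asg x y).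

(** In a finite matroid this also holds when [x = y] and some element is not simple, because a
    triple with a repetition never satisfies the relation. The statements that evaluate [adj]
    therefore assume distinct points. *)
Definition adj {T : Type} (A : lamM_structure T) (x y : T) : Prop :=
  exists z, ~ is_simple A z /\ ~ A 2%N (triple_asg x y z).

(** The closed walk through [x], [y], [x'], [y'] has an even number of non-edges: the product of its
    four signs is 1. *)
Definition even_cycle {T : Type} (A : lamM_structure T) (x x' y y' : T) : Prop :=
  (adj A x y <-> adj A x' y) <-> (adj A x y' <-> adj A x' y').

(** The bound variable has the last index, so [lift ord_max] re-embeds the free ones. *)
Definition FSimple {n : nat} (i : 'I_n) : formula n :=
  FForall (FOr (FEq (lift ord_max i) ord_max)
               (FRel 1%N (pair_asg (lift ord_max i) ord_max))).

Definition FAdj {n : nat} (i j : 'I_n) : formula n :=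
  FExists (FAnd (FNot (FSimple ord_max))
    (FNot (FRel 2%N (triple_asg (lift ord_max i) (lift ord_max j) ord_max)))).

Definition FIff {n : nat} (p q : formula n) : formula n :=
  FOr (FAnd p q) (FAnd (FNot p) (FNot q)).

Definition ord4 (k : nat) : 'I_4 := inord k.

Definition FEven : formula 4 :=
  FIff (FIff (FAdj (ord4 0) (ord4 2)) (FAdj (ord4 1) (ord4 2)))
       (FIff (FAdj (ord4 0) (ord4 3)) (FAdj (ord4 1) (ord4 3))).

Definition FCycle (b : bool) : formula 4 :=
  FAnd (FAnd (FAnd (FSimple (ord4 0)) (FSimple (ord4 1)))
             (FAnd (FSimple (ord4 2)) (FSimple (ord4 3))))
       (if b then FEven else FNot FEven).

Lemma ext_asg_max {T : Type} {n : nat} (v : 'I_n -> T) (x : T) :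
  ext_asg v x ord_max = x.
Proof. by rewrite /ext_asg unlift_none. Qed.

Lemma ext_asg_lift {T : Type} {n : nat} (v : 'I_n -> T) (x : T) (i : 'I_n) :
  ext_asg v x (lift ord_max i) = v i.
Proof. by rewrite /ext_asg liftK. Qed.

Lemma sat_FNot {T : Type} (A : lamM_structure T) {n : nat} (p : formula n) v :
  sat A (FNot p) v = ~ sat A p v.
Proof. by []. Qed.

Lemma sat_FAnd {T : Type} (A : lamM_structure T) {n : nat} (p q : formula n) v :
  sat A (FAnd p q) v = (sat A p v /\ sat A q v).
Proof. by []. Qed.

Lemma sat_FExists {T : Type} (A : lamM_structure T) {n : nat} (p : formula n.+1) v :
  sat A (FExists p) v = exists x, sat A p (ext_asg v x).
Proof. by []. Qed.

Lemma sat_FSimple {T : Type} (A : lamM_structure T) {n : nat} (i : 'I_n) (v : 'I_n -> T) :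
  sat A (FSimple i) v = is_simple A (v i).
Proof.
rewrite /FSimple /is_simple /=; congr (forall y, _); apply/funext => y.
by rewrite pair_asg_comp ext_asg_max ext_asg_lift.
Qed.

Lemma sat_FAdj {T : Type} (A : lamM_structure T) {n : nat} (i j : 'I_n) (v : 'I_n -> T) :
  sat A (FAdj i j) v = adj A (v i) (v j).
Proof.
rewrite /FAdj /adj sat_FExists; congr (exists z, _); apply/funext => z.
rewrite sat_FAnd !sat_FNot sat_FSimple ext_asg_max /=.
by rewrite triple_asg_comp ext_asg_max !ext_asg_lift.
Qed.

Lemma sat_FIff {T : Type} (A : lamM_structure T) {n : nat} (p q : formula n) v :
  sat A (FIff p q) v = (sat A p v <-> sat A q v).
Proof.
rewrite /FIff /=; apply/propext; case: (EM (sat A p v)); case: (EM (sat A q v)); tauto.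
Qed.

Lemma sat_FCycle {T : Type} (A : lamM_structure T) (b : bool) (v : 'I_4 -> T) :
  sat A (FCycle b) v =
  (((is_simple A (v (ord4 0)) /\ is_simple A (v (ord4 1))) /\
    (is_simple A (v (ord4 2)) /\ is_simple A (v (ord4 3)))) /\
   (even_cycle A (v (ord4 0)) (v (ord4 1)) (v (ord4 2)) (v (ord4 3)) <-> b)).
Proof.
have E : sat A FEven v =
  even_cycle A (v (ord4 0)) (v (ord4 1)) (v (ord4 2)) (v (ord4 3)).
  by rewrite /FEven !sat_FIff !sat_FAdj.
rewrite /FCycle !sat_FAnd !sat_FSimple; congr (_ /\ _).
case: b; rewrite ?sat_FNot E; apply/propext.
  by split=> [h|[_ h]]; [split|exact: h].
by split=> [h|[h _] /h].
Qed.

(** * Signs, codegrees and the signed count of 4-cycles *)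

Definition sgn_adj {T : Type} (A : lamM_structure T) (x y : T) : int :=
  if `[< is_simple A x /\ is_simple A y >] then (if `[< adj A x y >] then 1 else -1) else 0.

Lemma sgn_adj_norm {T : Type} (A : lamM_structure T) (x y : T) : `|sgn_adj A x y| <= 1.
Proof. by rewrite /sgn_adj; do 2?case: ifP. Qed.

Lemma asbool_iff (P Q : Prop) : `[< (P <-> Q) >] = (`[< P >] == `[< Q >]).
Proof.
apply/asboolP/eqP => [PQ|e]; [exact: (asbool_equiv_eq PQ)|exact: (asbool_eq_equiv e)].
Qed.

Lemma asboolb (b : bool) : `[< b >] = b.
Proof. exact/asboolP/idP. Qed.

(** If all four vertices are simple, exactly one of the two formulas holds and the product of the
    signs tells which; otherwise both sides are 0. The identity is pointwise, so it serves both
    finite counting and integration. *)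
Lemma sat_FCycle_sgn {T : Type} (A : lamM_structure T) (v : 'I_4 -> T) :
  `[< sat A (FCycle true) v >]%:R - `[< sat A (FCycle false) v >]%:R =
  (sgn_adj A (v (ord4 0)) (v (ord4 2)) * sgn_adj A (v (ord4 1)) (v (ord4 2))) *
  (sgn_adj A (v (ord4 0)) (v (ord4 3)) * sgn_adj A (v (ord4 1)) (v (ord4 3))).
Proof.
rewrite !sat_FCycle /sgn_adj /even_cycle !(asbool_and, asbool_iff) !asboolb.
case: `[< is_simple A (v (ord4 0)) >]; last by rewrite !mul0r.
case: `[< is_simple A (v (ord4 1)) >]; last by rewrite !(mul0r, mulr0).
case: `[< is_simple A (v (ord4 2)) >]; last by rewrite !(mul0r, mulr0).
case: `[< is_simple A (v (ord4 3)) >]; last by rewrite !(mul0r, mulr0).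
by do 4!case: `[< adj _ _ _ >].
Qed.

Lemma sum_ffun4 {T : finType} {V : nmodType} (G : T -> T -> T -> T -> V) :
  \sum_(v : {ffun 'I_4 -> T}) G (v (ord4 0)) (v (ord4 1)) (v (ord4 2)) (v (ord4 3)) =
  \sum_x \sum_x' \sum_y \sum_y' G x x' y y'.
Proof.
rewrite pair_bigA pair_bigA pair_bigA /=.
pose h (t : T * T * T * T) : {ffun 'I_4 -> T} :=
  [ffun i : 'I_4 => nth t.2 [:: t.1.1.1; t.1.1.2; t.1.2; t.2] i].
rewrite (reindex h) /=.
  by apply: eq_bigr => -[[[a b] c] d] _; rewrite !ffunE /= !inordK.
exists (fun v => (v (ord4 0), v (ord4 1), v (ord4 2), v (ord4 3))) => [[[[a b] c] d] _|v _].
  by rewrite !ffunE /= !inordK.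
apply/ffunP => i; rewrite ffunE /=.
case: i => [[|[|[|[|//]]]]] lti /=; congr (v _); apply/val_inj; by rewrite /= inordK.
Qed.

Lemma card_asbool_sum {T : finType} (P : T -> Prop) :
  (#|[set x | `[< P x >]]|%:R : int) = \sum_x `[< P x >]%:R.
Proof.
by rewrite -sum1_card natr_sum big_mkcond /=; apply: eq_bigr => x _; rewrite inE; case: ifP.
Qed.

Lemma sgn_adj_nonsimple {T : Type} (A : lamM_structure T) (x y : T) :
  ~ is_simple A x \/ ~ is_simple A y -> sgn_adj A x y = 0.
Proof. by rewrite /sgn_adj => H; case: asboolP => // -[? ?]; case: H. Qed.

Definition codegree {T : finType} (A : lamM_structure T) (x x' : T) : int :=
  \sum_y sgn_adj A x y * sgn_adj A x' y.

(** For fixed [x] and [x'], the sum over [y] and [y'] of the product of four signs factors as a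
    square. *)
Lemma card_cycle_diff {T : finType} (A : lamM_structure T) :
  #|[set v : {ffun 'I_4 -> T} | `[< sat A (FCycle true) v >]]|%:R
  - #|[set v : {ffun 'I_4 -> T} | `[< sat A (FCycle false) v >]]|%:R
  = \sum_x \sum_x' codegree A x x' ^+ 2.
Proof.
rewrite !card_asbool_sum -sumrB; under eq_bigr do rewrite sat_FCycle_sgn.
rewrite (sum_ffun4 (fun a b c d => sgn_adj A a c * sgn_adj A b c *
   (sgn_adj A a d * sgn_adj A b d))).
apply: eq_bigr => x _; apply: eq_bigr => x' _.
rewrite expr2 mulr_suml; apply: eq_bigr => y _; by rewrite mulr_sumr.
Qed.

(** * Matroids encoding the Paley sum graph *)

(** The range [2 * p] has room for every integer sum of two residues below [p], so collinearity is
    decided in the integers, without reduction mod [p]. *)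
Definition paley_line (p : nat) :=
  {w : 'I_(2 * p) | quad_char ((w : nat)%:R : 'F_p) == 1}.

Definition paley_point (p : nat) : finType := ('F_p + paley_line p * bool)%type.

(** The offsets make the simple parameters positive and the doubled ones negative, so the two kinds
    never coincide, and they cancel in the sum of two simple parameters and a doubled one, leaving
    the integer [a + b - w]. *)
Definition paley_coord (p : nat) (x : paley_point p) : rat :=
  match x with
  | inl a => (p + (a : nat))%:R
  | inr (w, _) => - (2 * p + (val w : nat))%:R
  end.

Lemma paley_point_nonempty p : (0 < #|paley_point p|)%N.
Proof. by apply/card_gt0P; exists (inl 0). Qed.

Definition paley_matroid (p : nat) : fin_matroid :=
  cubic_matroid (paley_coord p) (paley_point_nonempty p).

Lemma card_paley_point p : prime p -> (p <= #|paley_point p| <= 5 * p)%N.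
Proof.
move=> pp; rewrite card_sum card_Fp // card_prod card_bool leq_addr /=.
have : (#|{: paley_line p}| <= 2 * p)%N.
  by rewrite card_sig (leq_trans (max_card _)) // card_ord.
by move=> H; rewrite (_ : 5 * p = p + 2 * p * 2)%N; [rewrite leq_add2l leq_mul2r H orbT|lia].
Qed.

Lemma Fp_val_lt p (a : 'F_p) : prime p -> ((a : nat) < p)%N.
Proof. by move=> pp; rewrite -[X in (_ < X)%N](Fp_cast pp). Qed.

Lemma paley_simple p (x : paley_point p) : prime p ->
  is_simple (fm_structure (paley_matroid p)) x <-> (exists a : 'F_p, x = inl a).
Proof.
move=> pp; split=> [|[a ->]].
  case: x => [a _|[w b]]; first by exists a.
  (* Flipping the boolean gives the twin with the same parameter. *)
  move=> /(_ (inr (w, ~~ b)))[[] |/cubic_matroid_line]; first by case: b.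
  by rewrite /= eqxx.
case=> [b|[w b]].
  have [->|ab] := eqVneq a b; [by left|right].
  apply/cubic_matroid_line => /=; rewrite eqr_nat eqn_add2l.
  by apply: contra_neq ab => /val_inj.
right; apply/cubic_matroid_line => /=.
have p0 := prime_gt0 pp.
by rewrite -subr_eq0 opprK -natrD pnatr_eq0; lia.
Qed.

(** A doubled point is dependent with two distinct simple points only if [a + b = w] as integers,
    and the values [w] are exactly the residues in range. *)
Lemma paley_adj p (a b : 'F_p) : prime p -> a != b ->
  adj (fm_structure (paley_matroid p)) (inl a) (inl b) <-> quad_char (a + b) = 1.
Proof.
move=> pp ab; have p0 := prime_gt0 pp.
have sumE : ((a : nat) + (b : nat))%:R = a + b :> 'F_p by rewrite natrD !natr_Zp.
split=> [[z [nz H]]|ch].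
  case: z nz H => [c []|[w e] _ H]; first by apply/paley_simple => //; exists c.
  have wlt := ltn_ord (val w).
  suff -> : a + b = (val w : nat)%:R by exact/eqP/(valP w).
  (* Were the integers [a + b] and [w] different, the three parameters would be distinct with
     nonzero sum, hence independent. *)
  rewrite -sumE; congr (_%:R); apply/eqP; apply: contraPT isT => ne.
  case: H; apply/cubic_matroid_plane => /=; rewrite !inE negb_or andbT.
  rewrite eqr_nat eqn_add2l -![_ == - _]subr_eq0 !opprK -!natrD !pnatr_eq0.
  rewrite subr_eq0 eqr_nat; have -> : ((a : nat) == b) = false by apply/negbTE.
  move: p0 ne; rewrite /=; move: (nat_of_ord a) (nat_of_ord b) (nat_of_ord (sval w)).
  by move=> i j k; lia.
have wlt : (a + b < 2 * p)%N.
  have := Fp_val_lt p a pp; have := Fp_val_lt p b pp.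
  by move: (nat_of_ord a) (nat_of_ord b) => i j; lia.
have wch : quad_char ((Ordinal wlt : nat)%:R : 'F_p) == 1 by rewrite /= sumE ch.
exists (inr (Sub (Ordinal wlt) wch, true)); split; first by case/paley_simple.
move=> /cubic_matroid_plane /andP[_ /negP[]] /=.
rewrite -!natrD subr_eq0 eqr_nat; move: (nat_of_ord a) (nat_of_ord b) => i j.
by lia.
Qed.

(** At [a + b = 0] the character is 0 while the sign is -1, and at [a = b] adjacency degenerates;
    both cases are left to the error term. *)
Lemma paley_sgn_adj p (a b : 'F_p) : prime p -> a != b -> a + b != 0 ->
  sgn_adj (fm_structure (paley_matroid p)) (inl a) (inl b) = quad_char (a + b).
Proof.
move=> pp ab ab0; rewrite /sgn_adj asboolT; last first.
  by split; apply/paley_simple => //; [exists a|exists b].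
case: asboolP => [/(paley_adj p a b pp ab) -> //|nadj].
have : quad_char (a + b) != 1 by apply/eqP => /(paley_adj p a b pp ab).
by rewrite /quad_char (negbTE ab0); case: ifP.
Qed.

Lemma paley_char_corr p (a a' : 'F_p) : prime p -> (2 < p)%N -> a != a' ->
  \sum_(b : 'F_p) quad_char (a + b) * quad_char (a' + b) = -1.
Proof.
move=> pp p2 aa'; have F2 : (2%:R : 'F_p) != 0.
  by apply/eqP => /(congr1 (fun x : 'F_p => (x : nat))); rewrite val_Fp_nat // modn_small.
have d0 : a' - a != 0 by rewrite subr_eq0 eq_sym.
rewrite -(quad_char_corr _ _ F2 d0) [RHS](reindex (fun b => a + b)) /=; last first.
  exists (fun b => b - a) => b _; first by rewrite addrAC subrr add0r.
  by rewrite addrC subrK.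
by apply: eq_bigr => b _; congr (_ * quad_char _); rewrite [RHS]addrC addrA subrK.
Qed.

Lemma paley_codegreeE p (a a' : 'F_p) : prime p ->
  codegree (fm_structure (paley_matroid p)) (inl a) (inl a') =
  \sum_(b : 'F_p) sgn_adj (fm_structure (paley_matroid p)) (inl a) (inl b) *
    sgn_adj (fm_structure (paley_matroid p)) (inl a') (inl b).
Proof.
move=> pp; rewrite /codegree big_sumType /= [X in _ + X]big1 ?addr0 // => -[w e] _.
rewrite sgn_adj_nonsimple ?mul0r //; right => /(paley_simple p _ pp)[c].
by [].
Qed.

(* The character sum is only perturbed by the at most four [b] among [a, a', -a, -a']. *)
Lemma paley_codegree_le p (a a' : 'F_p) : prime p -> (2 < p)%N -> a != a' ->
  `|codegree (fm_structure (paley_matroid p)) (inl a) (inl a')| <= 9.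
Proof.
move=> pp p2 aa'; rewrite paley_codegreeE //.
set A := fm_structure _; pose ex := [:: a; a'; - a; - a'].
set S := \sum_b _.
have -> : S = -1 + \sum_b (sgn_adj A (inl a) (inl b) * sgn_adj A (inl a') (inl b)
    - quad_char (a + b) * quad_char (a' + b)).
  by rewrite -(paley_char_corr p a a' pp p2 aa') -big_split /=; apply: eq_bigr => b _; ring.
apply: le_trans (ler_normD _ _) _; rewrite normrN1 -lerBrDl.
apply: le_trans (ler_norm_sum _ _ _) _.
(* Outside [ex] the difference is 0, inside it is at most 2 in absolute value. Together with the
   leading -1 this gives 1 + 4 * 2 = 9. *)
apply: (@le_trans _ _ (\sum_(b : 'F_p) ((b \in ex)%:R * 2))).
  apply: ler_sum => b _; have [bex|] := boolP (b \in ex); last first.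
    rewrite !inE !negb_or => /and4P[ba ba' bna bna'].
    rewrite !paley_sgn_adj ?subrr ?normr0 //; rewrite ?[_ == b]eq_sym //.
      by rewrite addrC addr_eq0.
    by rewrite addrC addr_eq0.
  rewrite mul1r; apply: le_trans (ler_normB _ _) _; rewrite !normrM.
  rewrite (_ : 2 = 1 * 1 + 1 * 1) //; apply: lerD; apply: ler_pM => //;
    by [exact: sgn_adj_norm|exact: quad_char_norm].
have E : (\sum_(b : 'F_p) (b \in ex))%N = #|ex|.
  by rewrite -sum1_card [RHS]big_mkcond; apply: eq_bigr => b _; case: (b \in ex).
rewrite -mulr_suml -natr_sum E (_ : 9 - 1 = 4%:R * 2) // ler_pM2r // ler_nat.
exact: card_size.
Qed.

Lemma codegree_le_card {T : finType} (A : lamM_structure T) (x x' : T) :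
  `|codegree A x x'| <= #|T|%:R.
Proof.
apply: le_trans (ler_norm_sum _ _ _) _.
rewrite -sum1_card natr_sum; apply: ler_sum => y _.
by rewrite normrM -[1%:R]mulr1; apply: ler_pM => //; exact: sgn_adj_norm.
Qed.

(** Off the diagonal the codegree is at most 9, and it is 0 when one of the points is doubled; on
    the diagonal the trivial bound by the number of points is used. *)
Lemma paley_codegree_sq p (x x' : paley_point p) : prime p -> (2 < p)%N ->
  codegree (fm_structure (paley_matroid p)) x x' ^+ 2 <=
  81 + (x == x')%:R * #|paley_point p|%:R ^+ 2.
Proof.
move=> pp p2; set A := fm_structure _; set N := _%:R.
have sq (c M : int) : `|c| <= M -> c ^+ 2 <= M ^+ 2.
  move=> cM; rewrite -real_normK ?num_real //.
  by rewrite ler_sqr // nnegrE (le_trans _ cM).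
have [<-|xx'] := eqVneq x x'.
  by rewrite mul1r (le_trans (sq _ _ (codegree_le_card A x x))) // lerDr.
rewrite mul0r addr0.
have zero y y' : ~ is_simple A y \/ ~ is_simple A y' -> codegree A y y' ^+ 2 <= 81.
  move=> ns; rewrite /codegree big1 ?expr0n // => z _.
  by case: ns => ns; [rewrite [X in X * _]sgn_adj_nonsimple ?mul0r|
    rewrite [X in _ * X]sgn_adj_nonsimple ?mulr0]; auto.
case: (EM (is_simple A x)) => [sx|]; last by auto.
case: (EM (is_simple A x')) => [sx'|]; last by auto.
have [a ea] := (paley_simple p x pp).1 sx; have [a' ea'] := (paley_simple p x' pp).1 sx'.
suff /sq : `|codegree A x x'| <= 9 by [].
rewrite ea ea'.
by apply: paley_codegree_le => //; apply: contra_neq xx'; rewrite ea ea' => ->.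
Qed.

(** With N points, the diagonal accounts for at most N^3 and the additive constant 81 for at most 81
    N^2. *)
Lemma paley_codegree_sum p : prime p -> (2 < p)%N ->
  0 <= \sum_x \sum_x' codegree (fm_structure (paley_matroid p)) x x' ^+ 2
    <= 82 * #|paley_point p|%:R ^+ 3.
Proof.
move=> pp p2; set N : int := #|paley_point p|%:R; apply/andP; split.
  by apply: sumr_ge0 => x _; apply: sumr_ge0 => x' _; exact: sqr_ge0.
have N1 : 1 <= N by rewrite ler1n paley_point_nonempty.
apply: (@le_trans _ _ (\sum_(x : paley_point p) (81 * N + N ^+ 2))).
  apply: ler_sum => x _.
  apply: (@le_trans _ _ (\sum_(x' : paley_point p) (81 + (x == x')%:R * N ^+ 2))).
    by apply: ler_sum => x' _; exact: paley_codegree_sq.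
  rewrite big_split /= sumr_const -mulr_suml (bigD1 x) //= eqxx big1 ?addr0 ?mul1r; last first.
    by move=> y /negbTE; rewrite eq_sym => ->.
  by rewrite lerD2r -[leLHS]mulr_natr.
rewrite sumr_const -[X in X <= _]mulr_natr -/N.
have -> : 82 * N ^+ 3 = (81 * N * N + N ^+ 2) * N by ring.
rewrite ler_pM2r ?(lt_le_trans _ N1) // lerD2r.
by rewrite -[leLHS]mulr1 ler_wpM2l // mulr_ge0 // (le_trans _ N1).
Qed.

(** Dividing 82 N^3 by the N^4 assignments leaves 82 / N, and N is at least [p]. *)
Lemma stone_paley_cycle (R : realType) p : prime p -> (2 < p)%N ->
  0 <= stone_fin R (paley_matroid p) (FCycle true) -
       stone_fin R (paley_matroid p) (FCycle false) <= 82 / p%:R.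
Proof.
move=> pp p2; rewrite /stone_fin.
have := paley_codegree_sum p pp p2; rewrite -card_cycle_diff.
set N := #|paley_point p|; set c1 := #|_|; set c2 := #|_| => /andP[H0 H1].
have Np : (p <= N)%N by case/andP: (card_paley_point p pp).
have p0 : (0 : R) < p%:R by rewrite ltr0n prime_gt0.
have N0 : (0 : R) < N%:R by apply: lt_le_trans p0 _; rewrite ler_nat.
rewrite -mulrBl natrX; apply/andP; split.
  rewrite mulr_ge0 ?invr_ge0 ?exprn_ge0 ?(ltW N0) //.
  by move: H0; rewrite !subr_ge0 !ler_nat.
have H1R : (c1%:R - c2%:R : R) <= 82 * N%:R ^+ 3.
  by move: H1; rewrite -(ler_int R) rmorphB rmorphM rmorphXn /= !rmorph_nat.
rewrite ler_pdivrMr ?exprn_gt0 //; apply: le_trans H1R _.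
have -> : 82 / p%:R * N%:R ^+ 4 = 82 / p%:R * N%:R * N%:R ^+ 3 :> R.
  by rewrite (exprS _ 3) !mulrA.
apply: ler_wpM2r; first by rewrite exprn_ge0 ?ltW.
rewrite -mulrA ler_peMr //.
by rewrite mulrC ler_pdivlMr // mul1r ler_nat.
Qed.

(** There are at least [p] simple points among at most [5 * p] points. *)
Lemma stone_paley_simple (R : realType) p : prime p ->
  5^-1 <= stone_fin R (paley_matroid p) (FSimple (ord0 : 'I_1)).
Proof.
move=> pp; rewrite /stone_fin; case/andP: (card_paley_point p pp) => Np N5.
set N := #|paley_point p|; set c := #|_|; rewrite expn1.
have pc : (p <= c)%N.
  rewrite -[p in (p <= _)%N](card_Fp pp).
  pose h (a : 'F_p) : {ffun 'I_1 -> paley_point p} := [ffun=> inl a].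
  have hi : injective h by move=> a b /ffunP/(_ ord0); rewrite !ffunE => -[].
  rewrite -(card_codom hi); apply/subset_leq_card/fintype.subsetP => _ /codomP[a ->].
  rewrite inE; apply/asboolP; rewrite sat_FSimple ffunE; apply/paley_simple => //.
  by exists a.
have N0 : (0 : R) < N%:R by rewrite ltr0n paley_point_nonempty.
by rewrite ler_pdivlMr // ler_pdivrMl // -natrM ler_nat (leq_trans N5) // leq_mul2l pc orbT.
Qed.

(** * Integrals of bounded measurable functions *)

(** This class is closed under products, sections and partial integration, and its members are
    integrable for every probability, so each use of Fubini reduces to membership in it. *)
Definition bounded_mfun {d} {T : measurableType d} {R : realType} (f : T -> R) : Prop :=
  measurable_fun setT f /\ exists M : R, forall x, `|f x| <= M.

Section BoundedIntegrals.
Local Open Scope classical_set_scope.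
Context {d : measure_display} {T : measurableType d} {R : realType}.
Implicit Type P : probability T R.

Lemma bounded_integrable P (f : T -> R) : bounded_mfun f ->
  P.-integrable setT (EFin \o f).
Proof.
move=> [mf [M fM]]; apply: measurable_bounded_integrable => //.
  by rewrite -ge0_fin_numE // fin_num_measure.
exists M; split; first exact: num_real.
by move=> N MN x _; apply: (le_trans (fM x)); exact: ltW.
Qed.

Lemma bounded_EFin_Rintegral P (f : T -> R) : bounded_mfun f ->
  (\int[P]_x (f x)%:E)%E = (\int[P]_x f x)%:E.
Proof.
move=> bf; rewrite /Rintegral fineK //.
exact: (integrable_fin_num measurableT (bounded_integrable P f bf)).
Qed.

Lemma bounded_cst (r : R) : bounded_mfun (fun _ : T => r).
Proof. by split; [exact: measurable_cst|exists `|r|]. Qed.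

Lemma bounded_mul (f g : T -> R) : bounded_mfun f -> bounded_mfun g ->
  bounded_mfun (fun x => f x * g x).
Proof.
move=> [mf [M fM]] [mg [N gN]]; split; first exact: measurable_funM.
by exists (M * N) => x; rewrite normrM; exact: ler_pM.
Qed.

Lemma bounded_sub (f g : T -> R) : bounded_mfun f -> bounded_mfun g ->
  bounded_mfun (fun x => f x - g x).
Proof.
move=> [mf [M fM]] [mg [N gN]]; split; first exact: measurable_funB.
by exists (M + N) => x; rewrite (le_trans (ler_normB _ _)) // lerD.
Qed.

Lemma bounded_indic (A : set T) : measurable A -> bounded_mfun (\1_A : T -> R).
Proof.
move=> mA; split; first exact: measurable_indic.
by exists 1 => x; rewrite indicE; case: (_ \in _); rewrite ?normr1 ?normr0.
Qed.

Lemma Rintegral_indic P (A : set T) : measurable A -> \int[P]_x \1_A x = fine (P A).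
Proof. by move=> mA; rewrite /Rintegral integral_indic // setIT. Qed.

Lemma bounded_Rintegral_le P (f : T -> R) (M : R) : bounded_mfun f ->
  (forall x, `|f x| <= M) -> `|\int[P]_x f x| <= M.
Proof.
move=> bf fM; have If := bounded_integrable P f bf.
apply: le_trans (le_normr_Rintegral measurableT If) _.
have -> : M = \int[P]_x (fun _ : T => M) x.
  rewrite Rintegral_cst // -[LHS]mulr1; congr (_ * _).
  exact: (esym (congr1 fine (probability_setT P))).
apply: le_Rintegral => //; first exact: integrable_norm.
exact: (bounded_integrable P _ (bounded_cst M)).
Qed.

(* Expand [int (u - t * c)^2 >= 0] for all real [t]. *)
Lemma Rintegral_mul_null P (u c : T -> R) : bounded_mfun u -> bounded_mfun c ->
  \int[P]_x (c x * c x) = 0 -> \int[P]_x (u x * c x) = 0.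
Proof.
move=> bu bc c0; set a := \int[P]_x (u x * u x); set b := \int[P]_x _.
have H t : 0 <= a - t * b.
  (* The half absorbs the factor 2 of the cross term. *)
  have -> : a - t * b = \int[P]_x ((u x - t / 2 * c x) * (u x - t / 2 * c x)).
    pose k := t / 2.
    transitivity (\int[P]_x (u x * u x - (t * (u x * c x) - k * k * (c x * c x)))).
      have I1 := bounded_integrable P _ (bounded_mul _ _ bu bu).
      have buc := bounded_mul _ _ bu bc; have bcc := bounded_mul _ _ bc bc.
      have b1 := bounded_mul _ _ (bounded_cst t) buc.
      have b2 := bounded_mul _ _ (bounded_cst (k * k)) bcc.
      rewrite RintegralB //; last exact: (bounded_integrable P _ (bounded_sub _ _ b1 b2)).
      rewrite RintegralB //; [|exact: (bounded_integrable P _ b1)|exact: (bounded_integrable P _ b2)].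
      rewrite !RintegralZl //; [|exact: (bounded_integrable P _ bcc)|exact: (bounded_integrable P _ buc)].
      by rewrite c0 mulr0 subr0.
    by congr (Rintegral _ _ _); apply/funext => x; rewrite /k; field.
  by apply: Rintegral_ge0 => x _; rewrite -expr2 sqr_ge0.
apply/eqP; apply: contraT => b0.
(* For [b != 0] this value of [t] makes [a - t * b] equal to -1. *)
by have := H ((a + 1) / b); rewrite divfK // opprD addrA subrr add0r oppr_ge0 ler10.
Qed.

End BoundedIntegrals.

Section BoundedFubini.
Local Open Scope classical_set_scope.
Context {d d' : measure_display} {T : measurableType d} {T' : measurableType d'}
  {R : realType}.
Implicit Types (P : probability T R) (Q : probability T' R).

Lemma bounded_comp (f : T -> R) (g : T' -> T) : measurable_fun setT g ->
  bounded_mfun f -> bounded_mfun (fun x => f (g x)).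
Proof.
by move=> mg [mf [M fM]]; split; [exact: measurableT_comp|exists M].
Qed.

Lemma bounded_section (f : T * T' -> R) (x : T) : bounded_mfun f ->
  bounded_mfun (fun y => f (x, y)).
Proof.
move=> [mf [M fM]]; split; last by exists M.
exact: measurableT_comp mf (pair1_measurable x).
Qed.

(** The bound is inherited because [Q] has mass 1; measurability comes from Fubini's theorem on the
    product with [P]. *)
Lemma bounded_partial_integral P Q (f : T * T' -> R) : bounded_mfun f ->
  bounded_mfun (fun x => \int[Q]_y f (x, y)).
Proof.
move=> bf; split; last first.
  have [mf [M fM]] := bf; exists M => x.
  exact: (bounded_Rintegral_le Q _ _ (bounded_section f x bf)).
apply/measurable_EFinP.
have := @measurable_fubini_F _ _ _ _ _ P Q _ (bounded_integrable _ _ bf).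
congr (measurable_fun _ _); apply/funext => x.
by rewrite /fubini_F /= (bounded_EFin_Rintegral _ _ (bounded_section f x bf)).
Qed.

Lemma bounded_iterated_EFin P Q (f : T * T' -> R) : bounded_mfun f ->
  (\int[P]_x \int[Q]_y (f (x, y))%:E)%E = (\int[P]_x (\int[Q]_y f (x, y)))%:E.
Proof.
move=> bf; rewrite -(bounded_EFin_Rintegral _ _ (bounded_partial_integral P Q f bf)).
apply: eq_integral => x _.
exact: (bounded_EFin_Rintegral _ _ (bounded_section f x bf)).
Qed.

Lemma bounded_Fubini P Q (f : T * T' -> R) : bounded_mfun f ->
  \int[P]_x (\int[Q]_y f (x, y)) = \int[(P \x Q)%E]_z f z.
Proof.
move=> bf; apply: EFin_inj; rewrite -(bounded_EFin_Rintegral (P \x Q)%E _ bf).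
rewrite -bounded_iterated_EFin //.
exact: (integral12_prod_meas1 (bounded_integrable (P \x Q)%E _ bf)).
Qed.

End BoundedFubini.

Lemma bounded_Fubini_swap {d d' : measure_display} {T : measurableType d}
  {T' : measurableType d'} {R : realType} (P : probability T R) (Q : probability T' R)
  (f : T * T' -> R) : bounded_mfun f ->
  \int[P]_x (\int[Q]_y f (x, y)) = \int[Q]_y (\int[P]_x f (x, y)).
Proof.
move=> bf; apply: EFin_inj.
have bs : bounded_mfun (fun z : T' * T => f (z.2, z.1)).
  apply: (bounded_comp f (fun z : T' * T => (z.2, z.1))) => //.
  exact: measurable_fun_pair.
rewrite -bounded_iterated_EFin // -(bounded_iterated_EFin Q P _ bs) /=.
exact: (Fubini (bounded_integrable (P \x Q)%E _ bf)).
Qed.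

(** * Sign kernels with vanishing codegrees *)

Section NullSigns.
Local Open Scope classical_set_scope.
Context {d : measure_display} {T : measurableType d} {R : realType}.
Context (P : probability T R).

(** Let [F y] be the integral of [h (x, y)] over [x] in [A]. The integral of its square pairs the
    codegree [c], null in square mean, with the indicator of the square of [A], hence is 0. Then [F]
    pairs to 0 with the indicator of [B] as well. *)
Lemma rectangle_orthogonal (h : T * T -> R) (A B : set T) :
  bounded_mfun h -> measurable A -> measurable B ->
  \int[P]_x (\int[P]_x' ((\int[P]_y (h (x, y) * h (x', y))) *
                        (\int[P]_y (h (x, y) * h (x', y))))) = 0 ->
  \int[(P \x P)%E]_z (h z * \1_(A `*` B) z) = 0.
Proof.
move=> bh mA mB.
have bg : bounded_mfun (fun w : (T * T) * T => h (w.1.1, w.2) * h (w.1.2, w.2)).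
  apply: bounded_mul; apply: (bounded_comp h) => //; apply: measurable_fun_pair => //;
  exact: measurableT_comp.
pose c (z : T * T) := \int[P]_y (h (z.1, y) * h (z.2, y)).
have bc : bounded_mfun c.
  exact: (bounded_partial_integral (P \x P)%E P (fun w : (T * T) * T => h (w.1.1, w.2) * h (w.1.2, w.2)) bg).
have bcc := bounded_mul _ _ bc bc.
rewrite -/(c (_, _)) => H0.
have {H0}c0 : \int[(P \x P)%E]_z (c z * c z) = 0.
  by rewrite -(bounded_Fubini P P _ bcc).
have bA : bounded_mfun (\1_A : T -> R) by exact: bounded_indic.
have bB : bounded_mfun (\1_B : T -> R) by exact: bounded_indic.
have bu : bounded_mfun (fun z : T * T => \1_A z.1 * \1_A z.2 : R).
  by apply: bounded_mul; apply: (bounded_comp (\1_A : T -> R)).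
pose F y := \int[P]_x (\1_A x * h (x, y)).
have bAh : bounded_mfun (fun z : T * T => \1_A z.2 * h (z.2, z.1)).
  apply: bounded_mul; first exact: (bounded_comp (\1_A : T -> R)).
  by apply: (bounded_comp h) => //; exact: measurable_fun_pair.
have bF : bounded_mfun F by exact: (bounded_partial_integral P P _ bAh).
have F0 : \int[P]_y (F y * F y) = 0.
  have bG : bounded_mfun (fun w : (T * T) * T =>
      (\1_A w.1.1 * \1_A w.1.2) * (h (w.1.1, w.2) * h (w.1.2, w.2))).
    by apply: bounded_mul => //; apply: (bounded_comp (fun z : T * T => \1_A z.1 * \1_A z.2 : R)).
  have <- := Rintegral_mul_null (P \x P)%E _ _ bu bc c0.
  (* The square of [F y] becomes an integral over pairs; exchanging the order then integrates over
     [y] first and produces [c]. *)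
  transitivity (\int[P]_y (\int[(P \x P)%E]_z
     ((\1_A z.1 * \1_A z.2) * (h (z.1, y) * h (z.2, y))))).
    congr (Rintegral _ _ _); apply/funext => y.
    have bAy : bounded_mfun (fun x => \1_A x * h (x, y)).
      exact: (bounded_section _ y bAh).
    have bGy : bounded_mfun (fun z : T * T =>
       (\1_A z.1 * h (z.1, y)) * (\1_A z.2 * h (z.2, y))).
      by apply: bounded_mul; apply: (bounded_comp (fun x => \1_A x * h (x, y))).
    rewrite /F -RintegralZr //; last exact: (bounded_integrable P _ bAy).
    transitivity (\int[P]_x (\int[P]_x' ((\1_A x * h (x, y)) * (\1_A x' * h (x', y))))).
      congr (Rintegral _ _ _); apply/funext => x.
      by rewrite RintegralZl //; exact: (bounded_integrable P _ bAy).
    rewrite (bounded_Fubini P P _ bGy).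
    by congr (Rintegral _ _ _); apply/funext => z; ring.
  rewrite -(bounded_Fubini_swap (P \x P)%E P _ bG).
  congr (Rintegral _ _ _); apply/funext => z.
  rewrite /= RintegralZl //.
  exact: (bounded_integrable P _ (bounded_section _ z bg)).
have <- := Rintegral_mul_null P _ _ bB bF F0.
have bH : bounded_mfun (fun z : T * T => h z * \1_(A `*` B) z).
  by apply: bounded_mul => //; apply: bounded_indic; exact: measurableX.
rewrite -(bounded_Fubini P P _ bH) (bounded_Fubini_swap P P _ bH).
congr (Rintegral _ _ _); apply/funext => y.
have bAy : bounded_mfun (fun x => \1_A x * h (x, y)).
  exact: (bounded_section _ y bAh).
rewrite -RintegralZl //; last exact: (bounded_integrable P _ bAy).
congr (Rintegral _ _ _); apply/funext => x.
rewrite !indicE in_setX /=; case: (x \in A); case: (y \in B); rewrite /=; ring.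
Qed.

End NullSigns.

Section BalancedSigns.
Local Open Scope classical_set_scope.
Context {d : measure_display} {T : measurableType d} {R : realType}.
Context (P : probability T R).

(** Rectangles are stable under intersection and generate the product sigma-algebra, and the total
    mass is finite. *)
Lemma rectangle_measure_unique (mu nu : {measure set (T * T) -> \bar R}) :
  (mu setT < +oo)%E ->
  (forall A B, measurable A -> measurable B -> mu (A `*` B) = nu (A `*` B)) ->
  forall S, measurable S -> mu S = nu S.
Proof.
move=> muoo munu S mS.
pose C : set (set (T * T)) :=
  [set C | exists A, measurable A /\ exists B, measurable B /\ C = A `*` B].
apply: (measure_unique C (fun=> setT)) => //.
- rewrite measurable_prod_measurableType //; congr (<<s _ >>).
  rewrite predeqE; split => [[A mA [B mB <-]]|[A [mA [B [mB ->]]]]].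
    by exists A; split => //; exists B.
  by exists A => //; exists B.
- move=> _ _ [X1 [mX1 [X2 [mX2 ->]]]] [Y1 [mY1 [Y2 [mY2 ->]]]].
  rewrite -setXI; exists (X1 `&` Y1); split; first exact: measurableI.
  by exists (X2 `&` Y2); split => //; exact: measurableI.
- by move=> _; exists setT; split => //; exists setT; split => //; rewrite setXTT.
- by apply/seteqP; split=> // x _; exists 0%N.
- by move=> A [A1 [mA1 [A2 [mA2 ->]]]]; exact: munu.
Qed.

(** The restrictions of the product measure to [Ep] and to [En] agree on rectangles, hence on all
    measurable sets. At [Ep] they give the mass of [Ep] and that of the empty set; likewise at
    [En]. *)
Lemma balanced_signs_null (Ep En : set (T * T)) :
  measurable Ep -> measurable En -> Ep `&` En = set0 ->
  let h z : R := \1_Ep z - \1_En z in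
  \int[P]_x (\int[P]_x' ((\int[P]_y (h (x, y) * h (x', y))) *
                        (\int[P]_y (h (x, y) * h (x', y))))) = 0 ->
  (P \x P)%E Ep = 0%E /\ (P \x P)%E En = 0%E.
Proof.
move=> mEp mEn dis h h0; pose PP : probability (T * T)%type R := (P \x P)%E.
have bh : bounded_mfun h by apply: bounded_sub; exact: bounded_indic.
have key A B : measurable A -> measurable B ->
    mrestr PP mEp (A `*` B) = mrestr PP mEn (A `*` B).
  move=> mA mB.
  have mAB : measurable (A `*` B) by exact: measurableX.
  have m1 := measurableI _ _ mAB mEp; have m2 := measurableI _ _ mAB mEn.
  have e S : measurable S -> PP S = (\int[PP]_z \1_S z)%:E.
    by move=> mS; rewrite Rintegral_indic // fineK // fin_num_measure.
  rewrite -[LHS]/(PP (A `*` B `&` Ep)) -[RHS]/(PP (A `*` B `&` En)) (e _ m1) (e _ m2).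
  congr (_%:E).
  apply/eqP; rewrite -subr_eq0 -RintegralB //; [|exact: (bounded_integrable PP _ (bounded_indic _ m1))
    |exact: (bounded_integrable PP _ (bounded_indic _ m2))].
  apply/eqP; rewrite -[RHS](rectangle_orthogonal P h A B bh mA mB h0).
  congr (Rintegral _ _ _); apply/funext => z.
  by rewrite /h !indicI /=; ring.
have fin : (mrestr PP mEp setT < +oo)%E.
  rewrite -ge0_fin_numE // /mrestr; apply: fin_num_measure; exact: measurableI.
have E := rectangle_measure_unique _ _ fin key.
split.
  have e : PP (Ep `&` Ep) = PP (Ep `&` En) := E Ep mEp.
  by move: e; rewrite setIid dis => ->; exact: measure0.
have e : PP (En `&` Ep) = PP (En `&` En) := E En mEn.
by move: e; rewrite setIid setIC dis => <-; exact: measure0.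
Qed.

End BalancedSigns.

(** * Stone pairings of a modeling as iterated integrals *)

Definition ord2 (k : nat) : 'I_2 := inord k.

Definition FPairAdj (b : bool) : formula 2 :=
  FAnd (FAnd (FSimple (ord2 0)) (FSimple (ord2 1)))
       (if b then FAdj (ord2 0) (ord2 1) else FNot (FAdj (ord2 0) (ord2 1))).

Lemma sat_FPairAdj {T : Type} (A : lamM_structure T) (b : bool) (v : 'I_2 -> T) :
  sat A (FPairAdj b) v =
  ((is_simple A (v (ord2 0)) /\ is_simple A (v (ord2 1))) /\
   (adj A (v (ord2 0)) (v (ord2 1)) <-> b)).
Proof.
rewrite /FPairAdj !sat_FAnd !sat_FSimple; congr (_ /\ _).
case: b; rewrite ?sat_FNot sat_FAdj; apply/propext.
  by split=> [h|[_ h]]; [split|exact: h].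
by split=> [h|[h _] /h].
Qed.

Lemma sign_of_bools (K : pzRingType) (s t : bool) :
  (s && (t == true))%:R - (s && (t == false))%:R =
  (if s then (if t then 1 else -1) else 0 : int)%:~R :> K.
Proof. by case: s; case: t; rewrite ?subrr ?subr0 ?sub0r ?rmorphN ?rmorph1 ?rmorph0. Qed.

Section ModelingProducts.
Local Open Scope classical_set_scope.
Context {d : measure_display} {T : measurableType d} {R : realType}.

Definition no_asg : 'I_0 -> T := fun i => False_rect T (notF (ltn_ord i)).

Lemma exists_no_asg (S : set ('I_0 -> T)) : (exists v, S v) <-> S no_asg.
Proof.
split=> [[v Sv]|Sv]; last by exists no_asg.
by rewrite (_ : no_asg = v) //; apply/funext => -[].
Qed.

Lemma tcons_ord0 {U : Type} {k : nat} (x : U) (v : 'I_k -> U) : tcons x v ord0 = x.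
Proof. by rewrite /tcons unlift_none. Qed.

Lemma tcons_lift {U : Type} {k : nat} (x : U) (v : 'I_k -> U) (i : 'I_k) :
  tcons x v (lift ord0 i) = v i.
Proof. by rewrite /tcons liftK. Qed.

Lemma tcons_nth {U : Type} {k : nat} (x : U) (v : 'I_k.+1 -> U) (i : nat) : (i <= k)%N ->
  tcons x v (inord i.+1) = v (inord i).
Proof.
move=> ik; rewrite -(tcons_lift x v); congr (tcons x v _); apply/val_inj.
by rewrite /= !inordK.
Qed.

Lemma tcons_nth0 {U : Type} {k : nat} (x : U) (v : 'I_k -> U) : tcons x v (inord 0) = x.
Proof.
by rewrite (_ : inord 0 = ord0) ?tcons_ord0 //; apply/val_inj; rewrite /= inordK.
Qed.

Lemma measurable_tcons {d'} {X : measurableType d'} {k : nat} (f : X -> T)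
  (g : X -> 'I_k -> T) : measurable_fun setT f ->
  (forall i, measurable_fun setT (fun x => g x i)) ->
  forall i, measurable_fun setT (fun x => tcons (f x) (g x) i).
Proof. by move=> mf mg i; rewrite /tcons; case: unlift => [j|]; [exact: mg|]. Qed.

Lemma measurable_no_asg {d'} {X : measurableType d'} (i : 'I_0) :
  measurable_fun setT (fun _ : X => no_asg i).
Proof. by case: i. Qed.

(** The sets with measurable preimage form a sigma-algebra containing the generating cylinders. This
    carries definable sets over to iterated binary products. *)
Lemma prodn_measurable_preimage {d'} {X : measurableType d'} {k : nat}
  (g : X -> 'I_k -> T) (S : set ('I_k -> T)) :
  (forall i, measurable_fun setT (fun x => g x i)) ->
  prodn_measurable k S -> measurable (g @^-1` S).
Proof.
move=> mg; apply: (@smallest_sub _ _ _ [set S | measurable (g @^-1` S)]).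
  split=> /=.
  - by rewrite preimage_set0.
  - by move=> A mA; rewrite setTD preimage_setC; exact: measurableC.
  - by move=> A mA; rewrite preimage_bigcup; exact: bigcup_measurable.
move=> _ [i [B [mB ->]]] /=; rewrite -[X in measurable X]setTI; exact: (mg i).
Qed.

(** The nested [tcons] mirror the recursion of [prodn_measure], while the left-nested pairs let
    partial integrals peel off the last coordinate. *)
Definition asg4 (w : ((T * T) * T) * T) : 'I_4 -> T :=
  tcons w.1.1.1 (tcons w.1.1.2 (tcons w.1.2 (tcons w.2 no_asg))).

Lemma asg4E w : [/\ asg4 w (ord4 0) = w.1.1.1, asg4 w (ord4 1) = w.1.1.2,
  asg4 w (ord4 2) = w.1.2 & asg4 w (ord4 3) = w.2].
Proof.
rewrite /asg4 /ord4; split.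
- by rewrite tcons_nth0.
- by rewrite tcons_nth // tcons_nth0.
- by rewrite !tcons_nth // tcons_nth0.
- by rewrite !tcons_nth // tcons_nth0.
Qed.

Lemma measurable_asg4 (i : 'I_4) : measurable_fun setT (fun w => asg4 w i).
Proof.
rewrite /asg4; do 4?[apply: measurable_tcons].
- by apply: measurableT_comp => //; apply: measurableT_comp.
- by apply: measurableT_comp => //; apply: measurableT_comp.
- exact: measurableT_comp.
- by [].
- exact: measurable_no_asg.
Qed.

Definition iter4 (P : probability T R) (f : ((T * T) * T) * T -> R) : R :=
  \int[P]_a (\int[P]_b (\int[P]_c (\int[P]_e f (((a, b), c), e)))).

Lemma bounded_partials4 (P : probability T R) (f : ((T * T) * T) * T -> R) :
  bounded_mfun f ->
  [/\ bounded_mfun (fun w : (T * T) * T => \int[P]_e f (w, e)),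
      bounded_mfun (fun w : T * T => \int[P]_c (\int[P]_e f ((w, c), e))) &
      bounded_mfun (fun a : T => \int[P]_b (\int[P]_c (\int[P]_e f (((a, b), c), e))))].
Proof.
move=> bf; have b3 := bounded_partial_integral ((P \x P) \x P)%E P _ bf.
have b2 := bounded_partial_integral (P \x P)%E P _ b3.
by have b1 := bounded_partial_integral P P _ b2.
Qed.

Lemma iter4_EFin (P : probability T R) (f : ((T * T) * T) * T -> R) : bounded_mfun f ->
  (iter4 P f)%:E =
  (\int[P]_a \int[P]_b \int[P]_c \int[P]_e (f (((a, b), c), e))%:E)%E.
Proof.
move=> bf; have [b3 b2 b1] := bounded_partials4 P f bf.
rewrite -(bounded_EFin_Rintegral P _ b1); apply: eq_integral => a _.
rewrite -(bounded_EFin_Rintegral P _ (bounded_section _ a b2)).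
apply: eq_integral => b _.
rewrite -(bounded_EFin_Rintegral P _ (bounded_section _ (a, b) b3)).
apply: eq_integral => c _.
by rewrite -(bounded_EFin_Rintegral P _ (bounded_section _ (a, b, c) bf)).
Qed.

Lemma iter4_sub (P : probability T R) (f g : ((T * T) * T) * T -> R) :
  bounded_mfun f -> bounded_mfun g ->
  iter4 P (fun w => f w - g w) = iter4 P f - iter4 P g.
Proof.
move=> bf bg; have [f3 f2 f1] := bounded_partials4 P f bf.
have [g3 g2 g1] := bounded_partials4 P g bg.
rewrite /iter4 -RintegralB //; [|exact: bounded_integrable f1|exact: bounded_integrable g1].
congr (Rintegral _ _ _); apply/funext => a.
rewrite -RintegralB //; [|exact: bounded_integrable (bounded_section _ a f2)|
  exact: bounded_integrable (bounded_section _ a g2)].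
congr (Rintegral _ _ _); apply/funext => b.
rewrite -RintegralB //; [|exact: bounded_integrable (bounded_section _ (a, b) f3)|
  exact: bounded_integrable (bounded_section _ (a, b) g3)].
congr (Rintegral _ _ _); apply/funext => c.
by rewrite -RintegralB //; [exact: bounded_integrable (bounded_section _ (a, b, c) bf)|
  exact: bounded_integrable (bounded_section _ (a, b, c) bg)].
Qed.

(** The recursion ends on the empty assignment, where the value 0 or 1 is the indicator of [S] at
    the four chosen points. *)
Lemma prodn_measure4 (P : probability T R) (S : set ('I_4 -> T)) :
  prodn_measurable 4 S ->
  prodn_measure P 4 S = (iter4 P \1_(asg4 @^-1` S))%:E.
Proof.
move=> mS; rewrite iter4_EFin; last first.
  by apply/bounded_indic/prodn_measurable_preimage => //; exact: measurable_asg4.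
apply: eq_integral => a _; apply: eq_integral => b _.
apply: eq_integral => c _; apply: eq_integral => e _.
rewrite /= indicE; case: asboolP => [/exists_no_asg|] H.
  by rewrite mem_set.
by rewrite memNset // => Sabce; apply: H; apply/exists_no_asg.
Qed.

Lemma prodn_measure1 (P : probability T R) (S : set ('I_1 -> T)) :
  prodn_measurable 1 S ->
  prodn_measure P 1 S = P [set x | S (tcons x no_asg)].
Proof.
move=> mS; set V := [set x | _].
have mV : measurable V.
  apply: (prodn_measurable_preimage (fun x => tcons x no_asg)) => //.
  by apply: measurable_tcons => //; exact: measurable_no_asg.
rewrite -[V]setIT -(integral_indic P measurableT mV).
apply: eq_integral => a _; rewrite /= indicE; case: asboolP => [/exists_no_asg|] H.
  by rewrite mem_set.
by rewrite memNset // => Va; apply: H; apply/exists_no_asg.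
Qed.

Definition asg2 (z : T * T) : 'I_2 -> T := tcons z.1 (tcons z.2 no_asg).

Lemma asg2E z : asg2 z (ord2 0) = z.1 /\ asg2 z (ord2 1) = z.2.
Proof.
rewrite /asg2 /ord2; split; first by rewrite tcons_nth0.
by rewrite tcons_nth // tcons_nth0.
Qed.

Lemma measurable_asg2 (i : 'I_2) : measurable_fun setT (fun z => asg2 z i).
Proof.
rewrite /asg2; do 2?[apply: measurable_tcons] => //; exact: measurable_no_asg.
Qed.

(** The equality makes the integral of the squared codegrees of the sign kernel vanish, so edges and
    non-edges between simple points are both null. Together they cover the square of the set of
    simple points, whose measure therefore squares to 0. *)
Lemma modeling_simple_null (P : probability T R) (A : lamM_structure T) :
  is_modeling P A ->
  stone_modeling P A (FCycle true) = stone_modeling P A (FCycle false) ->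
  stone_modeling P A (FSimple (ord0 : 'I_1)) = 0%E.
Proof.
move=> [_ mA] eqs.
pose Ep := [set z | sat A (FPairAdj true) (asg2 z)].
pose En := [set z | sat A (FPairAdj false) (asg2 z)].
have mEp : measurable Ep.
  exact: (prodn_measurable_preimage asg2 [set v | sat A (FPairAdj true) v] measurable_asg2 (mA _ _)).
have mEn : measurable En.
  exact: (prodn_measurable_preimage asg2 [set v | sat A (FPairAdj false) v] measurable_asg2 (mA _ _)).
have EpE z : Ep z = ((is_simple A z.1 /\ is_simple A z.2) /\ (adj A z.1 z.2 <-> true)).
  by rewrite /Ep /mkset sat_FPairAdj (asg2E z).1 (asg2E z).2.
have EnE z : En z = ((is_simple A z.1 /\ is_simple A z.2) /\ (adj A z.1 z.2 <-> false)).
  by rewrite /En /mkset sat_FPairAdj (asg2E z).1 (asg2E z).2.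
have dis : Ep `&` En = set0.
  apply/seteqP; split => z; last by case.
  by case; rewrite EpE EnE => -[_ H] [_ H']; have := H.2 isT => /H'.1.
pose h (z : T * T) : R := \1_Ep z - \1_En z.
have hE z : h z = (sgn_adj A z.1 z.2)%:~R.
  rewrite /h !indicE -[z \in Ep]/(`[< Ep z >]) -[z \in En]/(`[< En z >]).
  rewrite EpE EnE /sgn_adj !(asbool_and, asbool_iff, asboolb).
  exact: sign_of_bools.
pose fp : ((T * T) * T) * T -> R := \1_(asg4 @^-1` [set v | sat A (FCycle true) v]).
pose fn : ((T * T) * T) * T -> R := \1_(asg4 @^-1` [set v | sat A (FCycle false) v]).
have bfp : bounded_mfun fp.
  exact: bounded_indic (prodn_measurable_preimage _ _ measurable_asg4 (mA _ _)).
have bfn : bounded_mfun fn.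
  exact: bounded_indic (prodn_measurable_preimage _ _ measurable_asg4 (mA _ _)).
have bh : bounded_mfun h by apply: bounded_sub; exact: bounded_indic.
have fE a b c e : fp (a, b, c, e) - fn (a, b, c, e) =
    (h (a, c) * h (b, c)) * (h (a, e) * h (b, e)).
  rewrite /fp /fn !indicE.
  rewrite -[_ \in asg4 @^-1` [set v | sat A (FCycle true) v]]/(`[< sat A (FCycle true) (asg4 (a, b, c, e)) >]).
  rewrite -[_ \in asg4 @^-1` [set v | sat A (FCycle false) v]]/(`[< sat A (FCycle false) (asg4 (a, b, c, e)) >]).
  have := congr1 (fun z : int => z%:~R : R) (sat_FCycle_sgn A (asg4 (a, b, c, e))).
  have [-> -> -> ->] := asg4E (a, b, c, e).
  by rewrite rmorphB !rmorph_nat => ->; rewrite !rmorphM !hE.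
have [] := balanced_signs_null P Ep En mEp mEn dis.
  (* Unfolding the squared codegree as an integral over [c] and [e] gives the difference of the two
     cycle pairings. *)
  transitivity (iter4 P (fun w => fp w - fn w)); last first.
    have ep := prodn_measure4 P [set v | sat A (FCycle true) v] (mA _ (FCycle true)).
    have en := prodn_measure4 P [set v | sat A (FCycle false) v] (mA _ (FCycle false)).
    have e : iter4 P fp = iter4 P fn.
      by apply: EFin_inj; exact: etrans (esym ep) (etrans eqs en).
    rewrite (iter4_sub P fp fn bfp bfn) e; exact: subrr.
  congr (Rintegral _ _ _); apply/funext => a; congr (Rintegral _ _ _); apply/funext => b.
  rewrite -/h.
  have bhh : bounded_mfun (fun y => h (a, y) * h (b, y)).
    by apply: bounded_mul; exact: bounded_section.
  have Ihh := bounded_integrable P _ bhh.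
  apply: (etrans (esym (RintegralZr (\int[P]_y (h (a, y) * h (b, y))) measurableT Ihh))).
  congr (Rintegral _ _ _); apply/funext => c.
  apply: (etrans (esym (RintegralZl (h (a, c) * h (b, c)) measurableT Ihh))).
  by congr (Rintegral _ _ _); apply/funext => e; rewrite fE.
move=> Ep0 En0; rewrite /stone_modeling prodn_measure1; last exact: mA.
set V := [set x | _].
have mV : measurable V.
  apply: (prodn_measurable_preimage (fun x => tcons x no_asg) [set v | sat A (FSimple ord0) v]).
    by apply: measurable_tcons => //; exact: measurable_no_asg.
  exact: mA.
have VE x : V x = is_simple A x by rewrite /V /mkset sat_FSimple tcons_ord0.
have VV : V `*` V `<=` Ep `|` En.
  move=> z [V1 V2]; have s1 : is_simple A z.1 by rewrite -VE.
  have s2 : is_simple A z.2 by rewrite -VE.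
  case: (EM (adj A z.1 z.2)) => adjz; [left; rewrite EpE|right; rewrite EnE].
    exact: (conj (conj s1 s2) (conj (fun=> isT) (fun=> adjz))).
  exact: (conj (conj s1 s2) (conj (fun a => False_ind _ (adjz a)) (fun f => False_ind _ (notF f)))).
have mVV : measurable (V `*` V) by exact: measurableX.
pose PP : probability (T * T)%type R := (P \x P)%E.
have PPU : (PP (Ep `|` En) <= 0)%E.
  apply: le_trans (measureU2 PP mEp mEn) _; rewrite le_eqVlt; apply/orP; left; apply/eqP.
  by apply: (etrans _ (adde0 0%E)); congr (_ + _)%E; [exact: Ep0|exact: En0].
have PPV : PP (V `*` V) = 0%E.
  apply: le_anti; rewrite measure_ge0 andbT; apply: le_trans PPU.
  exact: (le_measure PP (mem_set mVV) (mem_set (measurableU _ _ mEp mEn)) VV).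
have : (P V * P V = 0)%E by exact: (etrans (esym (product_measure1E P P mV mV)) PPV).
by move/eqP; rewrite mule_eq0 orbb => /eqP.
Qed.

End ModelingProducts.

(** * Convergent subsequences from an ultrafilter *)

Section DiagonalSubsequence.
Local Open Scope classical_set_scope.
Context {R : realType}.

(** By compactness of the unit interval the image ultrafilter has a cluster point, and a cluster
    point of an ultrafilter is a limit. *)
Lemma ultra_limit (U : set_system nat) (u : nat -> R) : UltraFilter U ->
  (forall m, 0 <= u m <= 1) ->
  exists L, forall e, 0 < e -> U [set m | `|L - u m| < e].
Proof.
move=> UU u01.
have [L [_ clL]] := @segment_compact R 0 1 (u @ U) _ (filterS (fun m _ => u01 m) filterT).
exists L => e e0; have [//|UC] := in_ultra_setVsetC [set m | `|L - u m| < e] UU.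
have FA : (u @ U) [set y | ~ `|L - y| < e] by [].
by have [y [/= ny]] := clL _ _ FA (nbhsx_ballx L e e0).
Qed.

(** One ultrafilter finer than the eventual filter yields all the limits [L i] at once; [g n] is
    then an index from [n] on at which the first [n] sequences are within [1 / (n + 1)] of their
    limits. The map [g] may fail to be monotone, but [n <= g n] sends it to infinity. *)
Lemma diagonal_subsequence (u : nat -> nat -> R) : (forall i m, 0 <= u i m <= 1) ->
  exists g : nat -> nat, (forall n, (n <= g n)%N) /\ forall i, cvgn (fun n => u i (g n)).
Proof.
move=> u01; have [U [UU ooU]] := ultraFilterLemma (eventually_filter : ProperFilter \oo).
have /choice [L LP] i := ultra_limit U (u i) UU (u01 i).
have /choice [g gP] n : exists m, (n <= m)%N /\ forall i : 'I_n, `|L i - u i m| < n.+1%:R^-1.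
  have e0 : (0 : R) < n.+1%:R^-1 by rewrite invr_gt0.
  have U1 : U [set m | (n <= m)%N] by apply: ooU; exact: nbhs_infty_ge.
  have U2 : U [set m | forall i : 'I_n, `|L i - u i m| < n.+1%:R^-1].
    by apply: filter_forall => i; exact: LP.
  by have [m [? ?]] := filter_ex (filterI U1 U2); exists m.
exists g; split=> [n|i]; first by have [] := gP n.
apply/cvg_ex; exists (L i); apply/cvgrPdist_lt => _/posnumP[e].
near=> n; have [_ gn] := gP n.
have ltin : (i < n)%N by near: n; exact: nbhs_infty_gt.
apply: lt_trans (gn (Ordinal ltin)) _.
by near: n; exact: near_infty_natSinv_lt.
Unshelve. all: by end_near.
Qed.

End DiagonalSubsequence.

Lemma stone_fin_01 (R : realType) (M : fin_matroid) (k : nat) (phi : formula k) :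
  0 <= stone_fin R M phi <= 1.
Proof.
rewrite /stone_fin divr_ge0 //=.
have N0 : (0 : R) < (#|fm_type M| ^ k)%N%:R.
  by rewrite ltr0n expn_gt0 fm_nonempty.
rewrite ler_pdivrMr // mul1r ler_nat (leq_trans (max_card _)) //.
by rewrite card_ffun card_ord.
Qed.

(** Formulas are countable and Stone pairings lie in the unit interval, so the diagonal argument
    handles all of them together. *)
Lemma fo_convergent_subsequence (R : realType) (M : nat -> fin_matroid) :
  exists g : nat -> nat, (forall n, (n <= g n)%N) /\ fo_convergent R (fun n => M (g n)).
Proof.
(* Integers that code no formula get the constant sequence 0, which respects the bounds. *)
pose u i m : R :=
  if unpickle i is Some (k, t) then
    if formula_decode t k is Some phi then stone_fin R (M m) phi else 0
  else 0.
have u01 i m : 0 <= u i m <= 1.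
  rewrite /u; case: (unpickle i) => [[k t]|]; last by rewrite lexx ler01.
  by case: formula_decode => [phi|]; [exact: stone_fin_01|rewrite lexx ler01].
have [g [ng gP]] := diagonal_subsequence u u01; exists g; split=> // k phi.
by have := gP (pickle (k, formula_code phi)); rewrite /u pickleK formula_codeK.
Qed.

(** * Choice of the primes and conclusion *)

(** A prime beyond [n + 2] is odd and turns the bound in [p] into one in [n]. *)
Lemma paley_family (R : realType) : exists M : nat -> fin_matroid,
  (forall n, fm_rank_le (M n) 3 /\ representable_Q (M n)) /\
  forall n,
    0 <= stone_fin R (M n) (FCycle true) - stone_fin R (M n) (FCycle false) <= 82 / n.+1%:R /\
    5^-1 <= stone_fin R (M n) (FSimple (ord0 : 'I_1)).
Proof.
pose p n := s2val (prime_above n.+2).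
have p_prime n : prime (p n) := s2valP' (prime_above n.+2).
have p_gt n : (n.+2 < p n)%N := s2valP (prime_above n.+2).
exists (fun n => paley_matroid (p n)); split=> n.
  split; [exact: vector_matroid_rank|exact: vector_matroid_representable].
split; last exact: stone_paley_simple.
have p2 : (2 < p n)%N by apply: leq_trans (p_gt n); rewrite !ltnS.
have /andP[-> /le_trans ->] // := stone_paley_cycle R (p n) (p_prime n) p2.
have np : (n.+1%:R : R) <= (p n)%:R by rewrite ler_nat ltnW // ltnW.
apply: ler_wpM2l => //; rewrite lef_pV2 // posrE ltr0n //; exact: prime_gt0.
Qed.

Theorem theorem5p1 (R : realType) :
  exists M : nat -> fin_matroid,
    (forall n, fm_rank_le (M n) 3 /\ representable_Q (M n)) /\
    fo_convergent R M /\
    ~ has_limit_matroid_modeling R M.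
Proof.
have [M [MQ Mstone]] := paley_family R.
have [g [gn conv]] := fo_convergent_subsequence R M.
exists (fun n => M (g n)); split=> [n|]; first exact: MQ.
split=> //; case=> [d [T [P [A [modA _ lim]]]]].
pose s k (phi : formula k) n := stone_fin R (M (g n)) phi.
(* Since [n <= g n], the gap along the subsequence is still at most [82 / (n + 1)]. *)
have diff0 : ((fun n => s _ (FCycle true) n - s _ (FCycle false) n) @ \oo --> (0 : R))%classic.
  apply: (@squeeze_cvgr _ _ _ _ (cst 0) (fun n => 82 * n.+1%:R^-1)).
  - apply: nearW => n; have [/andP[-> H] _] := Mstone (g n); apply: le_trans H _.
    have ng : (n.+1%:R : R) <= (g n).+1%:R by rewrite ler_nat ltnS gn.
    by apply: ler_wpM2l => //; rewrite lef_pV2 // posrE ltr0n.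
  - exact: cvg_cst.
  - rewrite -[X in (_ --> X)%classic](mulr0 82); apply: cvgM; [exact: cvg_cst|exact: cvg_harmonic].
have lim_eq : limn (s _ (FCycle true)) = limn (s _ (FCycle false)).
  apply/eqP; rewrite -subr_eq0 -limB; [|exact: conv|exact: conv].
  by apply/eqP/cvg_lim.
have eqs : stone_modeling P A (FCycle true) = stone_modeling P A (FCycle false).
  by rewrite !lim; congr (_%:E).
(* The simple points would be null in the modeling, although they make up at least a fifth of every
   matroid in the sequence. *)
have := modeling_simple_null P A modA eqs; rewrite lim => -[lim0].
have : 5^-1 <= limn (s _ (FSimple (ord0 : 'I_1))).
  by apply: limr_ge; [exact: conv|apply: nearW => n; exact: (Mstone (g n)).2].
by rewrite /s lim0 invr_le0 lern0.
Qed.
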